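(* Let $L$ be a multiplicative lattice and let $H\subseteq L$ be a wire of $L$. Then the map $$r:\mathcal{P}(H)\rightarrow\mathcal{P}(H),\qquad X_r=H\cap[0,\bigvee X]\quad (X\subseteq H)$$ (where $\bigvee X$ is computed in $L$) is a weak ideal system on the monoid $H$, and it is a lifting of $L$, i.e. the multiplicative lattice $I_r(H)$ of $r$-ideals of $H$ is isomorphic to $L$.
   Context: A multiplicative lattice is a complete lattice $L$ with least element $0$ and greatest element $1$, equipped with a commutative monoid operation with identity $1$ that is completely join distributive: $x\cdot\bigvee A=\bigvee_{a\in A}xa$ for all $x\in L$, $A\subseteq L$. Isomorphism of multiplicative lattices means a bijection preserving and reflecting the order and preserving multiplication. For $a,b\in L$, $[a,b]=\{x\in L\mid a\le x\le b\}$. A monoid means a commutative monoid with identity $1$ and zero element $0$ (so $0x=0$ for all $x$); a submonoid of $L$ is a multiplicatively closed subset containing $1$ and $0$. A subset $C\subseteq L$ generates $L$ (as a lattice) if every element of $L$ is a join of some (possibly infinitely many, possibly no) elements of $C$. A wire of $L$ is a submonoid $H$ of $L$ which generates $L$ as a lattice. Let $H$ be a monoid, $\mathcal{P}(H)$ its power set. A weak ideal system on $H$ is a map $r:\mathcal{P}(H)\to\mathcal{P}(H)$, $X\mapsto X_r$, such that: (s1) $XH\subseteq X_r$ for all $X\subseteq H$; (s2) $X\subseteq Y\subseteq H$ implies $X_r\subseteq Y_r$; (s3) $(X_r)_r=X_r$ for all $X\subseteq H$; (s4) $cX_r\subseteq(cX)_r$ for all $X\subseteq H$, $c\in H$. The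 elements of the image of $r$ are called $r$-ideals, and $I_r(H)=\{X_r\mid X\subseteq H\}$ is the set of all $r$-ideals; it is a multiplicative lattice ordered by inclusion, with multiplication $(X,Y)\mapsto(XY)_r$, where $XY=\{xy\mid x\in X,y\in Y\}$, join $\bigvee\Gamma=(\bigcup\Gamma)_r$ and meet $\bigwedge\Gamma=\bigcap\Gamma$ for $\Gamma\subseteq I_r(H)$ (with empty meet equal to $H$). *)

(* Defs.v *)
From HB Require Import structures.
From mathcomp Require Import all_boot all_order.
From mathcomp Require Import boolp classical_sets.

Set Implicit Arguments.
Unset Strict Implicit.
Unset Printing Implicit Defensive.

Import Order.TTheory.
Local Open Scope classical_set_scope.
Local Open Scope order_scope.
Local Open Scope group_scope.

HB.mixin Record TBLattice_isComplete d T of Order.TBLattice d T := {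
  bigjoin : set T -> T;
  bigmeet : set T -> T;
  bigjoinP : forall A : set T, supremums A (bigjoin A);
  bigmeetP : forall A : set T, infimums A (bigmeet A)
}.

#[short(type="completeLatticeType")]
HB.structure Definition CompleteLattice d :=
  {T of TBLattice_isComplete d T & Order.TBLattice d T}.

HB.factory Record POrder_isCompleteLattice d T of Order.POrder d T := {
  bigjoin : set T -> T;
  bigmeet : set T -> T;
  bigjoinP : forall A : set T, supremums A (bigjoin A);
  bigmeetP : forall A : set T, infimums A (bigmeet A)
}.

HB.builders Context d T of POrder_isCompleteLattice d T.

Let meet (x y : T) := bigmeet [set x; y].
Let join (x y : T) := bigjoin [set x; y].
Let bottom : T := bigjoin set0.
Let top : T := bigmeet set0.

Fact lexI x y z : (x <= meet y z) = (x <= y) && (x <= z).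
Proof.
have [lb glb] := bigmeetP [set y; z].
apply/idP/andP => [le|[xy xz]]; last by apply: glb => t [] ->.
by split; apply: (le_trans le); apply: lb; [left|right].
Qed.

Fact leUx x y z : (join x y <= z) = (x <= z) && (y <= z).
Proof.
have [ub lub] := bigjoinP [set x; y].
apply/idP/andP => [le|[xz yz]]; last by apply: lub => t [] ->.
by split; apply: le_trans le; apply: ub; [left|right].
Qed.

Fact le0x (x : T) : bottom <= x.
Proof. by have [_] := bigjoinP set0; apply. Qed.

Fact lex1 (x : T) : x <= top.
Proof. by have [_] := bigmeetP set0; apply. Qed.

HB.instance Definition _ := Order.POrder_isMeetSemilattice.Build d T lexI.
HB.instance Definition _ := Order.POrder_isJoinSemilattice.Build d T leUx.
HB.instance Definition _ := Order.hasBottom.Build d T le0x.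
HB.instance Definition _ := Order.hasTop.Build d T lex1.
HB.instance Definition _ := TBLattice_isComplete.Build d T bigjoinP bigmeetP.

HB.end.

HB.mixin Record Monoid_isCommutative T of Monoid T := {
  mulmC : commutative (@mul T)
}.

#[short(type="comMonoidType")]
HB.structure Definition ComMonoid := {T of Monoid_isCommutative T & Monoid T}.

HB.mixin Record ComMonoid_hasZero T of ComMonoid T := {
  zerom : T;
  mul0m : left_zero zerom (@mul T)
}.

#[short(type="comMonoidWithZeroType")]
HB.structure Definition ComMonoidWithZero :=
  {T of ComMonoid_hasZero T & ComMonoid T}.

HB.mixin Record CompleteLattice_isMultiplicative d T
    of CompleteLattice d T & ComMonoid T := {
  onem_top : 1 = \top :> T;
  mulm_bigjoin : forall (x : T) (A : set T),
    x * bigjoin A = bigjoin [set x * a | a in A]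
}.

#[short(type="multLatticeType")]
HB.structure Definition MultLattice d :=
  {T of CompleteLattice_isMultiplicative d T & CompleteLattice d T
      & ComMonoid T}.

Definition mlattice_isomorphic d1 (L1 : multLatticeType d1)
    d2 (L2 : multLatticeType d2) : Prop :=
  exists f : L1 -> L2,
    [/\ bijective f,
        forall x y : L1, (f x <= f y) = (x <= y)
      & forall x y : L1, f (x * y) = f x * f y].

Section MultLatticeTheory.
Context {d : Order.disp_t} {L : multLatticeType d}.

Lemma bigjoin0 : bigjoin set0 = \bot :> L.
Proof.
by apply/eqP; rewrite -lex0; have [_] := bigjoinP (set0 : set L); apply.
Qed.

Lemma mulm_bot (x : L) : x * \bot = \bot.
Proof. by rewrite -bigjoin0 mulm_bigjoin image_set0. Qed.

End MultLatticeTheory.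

(* The least element of [L] is absorbing ([mulm_bot]), so it is the zero of
   [L] as a monoid. *)
Record submonoid d (L : multLatticeType d) (H : set L) : Prop := Submonoid {
  submonoid1 : H 1;
  submonoid0 : H \bot;
  submonoidM : forall x y, H x -> H y -> H (x * y)
}.

Definition generates d (L : completeLatticeType d) (C : set L) : Prop :=
  forall x : L, exists2 A : set L, A `<=` C & x = bigjoin A.

Record wire d (L : multLatticeType d) := Wire {
  wire_set :> set L;
  wire_submonoid : submonoid wire_set;
  wire_generates : generates wire_set
}.

Definition wire_monoid d (L : multLatticeType d) (H : wire L) : Type :=
  set_type (wire_set H).

Section WireMonoid.
Context {d : Order.disp_t} {L : multLatticeType d} (H : wire L).
Local Notation M := (wire_monoid H).

HB.instance Definition _ := SubChoice.copy M (set_type (wire_set H)).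

Let wone : M := SigSub (mem_set (submonoid1 (wire_submonoid H))).
Let wzero : M := SigSub (mem_set (submonoid0 (wire_submonoid H))).
Let wmul (x y : M) : M :=
  SigSub (mem_set
    (submonoidM (wire_submonoid H) (set_valP x) (set_valP y))).

Fact wire_mulA : associative wmul.
Proof. by move=> x y z; apply: val_inj => /=; rewrite mulgA. Qed.
Fact wire_mul1m : left_id wone wmul.
Proof. by move=> x; apply: val_inj => /=; rewrite mul1g. Qed.
Fact wire_mulm1 : right_id wone wmul.
Proof. by move=> x; apply: val_inj => /=; rewrite mulg1. Qed.
HB.instance Definition _ :=
  isMonoid.Build M wire_mulA wire_mul1m wire_mulm1.

Fact wire_mulC : commutative (@mul M).
Proof. by move=> x y; apply: val_inj; rewrite /= mulmC. Qed.
HB.instance Definition _ := Monoid_isCommutative.Build M wire_mulC.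

Fact wire_mul0m : left_zero wzero (@mul M).
Proof. by move=> x; apply: val_inj; rewrite /= mulmC mulm_bot. Qed.
HB.instance Definition _ := ComMonoid_hasZero.Build M wire_mul0m.

End WireMonoid.

Definition mulset (M : comMonoidWithZeroType) (X Y : set M) : set M :=
  [set x * y | x in X & y in Y].

Record weak_ideal_system (M : comMonoidWithZeroType) (r : set M -> set M)
    : Prop := WeakIdealSystem {
  wis_sub : forall X, mulset X setT `<=` r X;
  wis_mono : forall X Y, X `<=` Y -> r X `<=` r Y;
  wis_idem : forall X, r (r X) = r X;
  wis_mul : forall X c, mulset [set c] (r X) `<=` r (mulset [set c] X)
}.

(* The set I_r(M) of r-ideals; the proof that [r] is a weak ideal system is an
   argument because the lattice operations below depend on it. *)
Definition ideals (M : comMonoidWithZeroType) (r : set M -> set M)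
    (rP : weak_ideal_system r) : Type := set_type (range r).

Section Mulset.
Context {M : comMonoidWithZeroType}.
Implicit Types X Y Z : set M.

Lemma mulsetC X Y : mulset X Y = mulset Y X.
Proof.
by apply/seteqP; split=> _ [x Xx [y Yy <-]]; exists y => //; exists x;
  rewrite // mulmC.
Qed.

Lemma mulsetA X Y Z : mulset X (mulset Y Z) = mulset (mulset X Y) Z.
Proof.
apply/seteqP; split=> [_ [x Xx [_ [y Yy [z Zz <-]] <-]]|].
  by exists (x * y); [exists x => //; exists y | exists z; rewrite ?mulgA].
move=> _ [_ [x Xx [y Yy <-]] [z Zz <-]].
by exists x => //; exists (y * z); [exists y => //; exists z|rewrite mulgA].
Qed.

Lemma mulsetSr X Y Z : Y `<=` Z -> mulset X Y `<=` mulset X Z.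
Proof. by move=> YZ _ [x Xx [y /YZ Zy <-]]; exists x => //; exists y. Qed.

End Mulset.

Section IdealLattice.
Context {M : comMonoidWithZeroType} {r : set M -> set M}.
Context (rP : weak_ideal_system r).
Local Notation I := (ideals rP).
Implicit Types (X Y : set M) (A B C : I) (G : set I).

HB.instance Definition _ := SubChoice.copy I (set_type (range r)).
HB.instance Definition _ :=
  [SubChoice_isSubPOrder of I by <: with set_display].

Let mkI X : I := SigSub (mem_set (imageT r X)).

Lemma le_idealsE A B : (A <= B) = `[< val A `<=` val B >].
Proof. by []. Qed.

Lemma ideals_fix A : r (val A) = val A.
Proof. by have [X _ <-] := set_valP A; rewrite (wis_idem rP). Qed.

Lemma wis_ext X : X `<=` r X.
Proof. by move=> x Xx; apply: (wis_sub rP); exists x => //; exists 1;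
  rewrite // mulg1. Qed.

Lemma wis_min X Y : X `<=` r Y -> r X `<=` r Y.
Proof. by move=> /(wis_mono rP); rewrite (wis_idem rP). Qed.

Lemma wis_mulr X Y : r (mulset X (r Y)) = r (mulset X Y).
Proof.
apply/seteqP; split; last exact/(wis_mono rP)/mulsetSr/wis_ext.
apply: wis_min => _ [x Xx [y rYy <-]].
have: r (mulset [set x] Y) (x * y).
  by apply: (wis_mul rP); exists x => //; exists y.
by apply: (wis_mono rP) => _ [_ -> [z Yz <-]]; exists x => //; exists z.
Qed.

Lemma wis_mull X Y : r (mulset (r X) Y) = r (mulset X Y).
Proof. by rewrite mulsetC wis_mulr mulsetC. Qed.

Lemma wis1 : r [set 1] = setT.
Proof.
apply/seteqP; split=> // x _; apply: (wis_sub rP).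
by exists 1 => //; exists x; rewrite // mul1g.
Qed.

Let ijoin G : I := mkI (\bigcup_(A in G) val A).

Fact bigcap_fix G : r (\bigcap_(A in G) val A) = \bigcap_(A in G) val A.
Proof.
apply/seteqP; split=> [x rx A GA|]; last exact: wis_ext.
by rewrite -ideals_fix; apply: (wis_mono rP) rx => y; apply.
Qed.

Let imeet G : I :=
  SigSub (mem_set (ex_intro2 _ _ _ Logic.I (bigcap_fix G))
    : \bigcap_(A in G) val A \in range r).

Fact ideals_bigjoinP G : supremums G (ijoin G).
Proof.
split=> [A GA|B ubB]; rewrite le_idealsE; apply/asboolP => /=.
  by apply: subset_trans (@wis_ext _) => x Ax; exists A.
rewrite -ideals_fix; apply: (wis_mono rP) => x [A GA].
by have := ubB _ GA; rewrite le_idealsE => /asboolP; apply.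
Qed.

Fact ideals_bigmeetP G : infimums G (imeet G).
Proof.
split=> [A GA|B lbB]; rewrite le_idealsE; apply/asboolP => /= x.
  exact.
by move=> Bx A GA; have := lbB _ GA; rewrite le_idealsE => /asboolP; apply.
Qed.

HB.instance Definition _ :=
  POrder_isCompleteLattice.Build set_display I ideals_bigjoinP ideals_bigmeetP.

Let imul A B : I := mkI (mulset (val A) (val B)).
(* [r [set 1] = setT] by [wis1]. *)
Let ione : I := mkI [set 1].

Fact ideals_mulC : commutative imul.
Proof. by move=> A B; apply: val_inj; rewrite /= mulsetC. Qed.

Fact ideals_mulA : associative imul.
Proof.
by move=> A B C; apply: val_inj; rewrite /= wis_mulr wis_mull mulsetA.
Qed.

Fact ideals_mul1m : left_id ione imul.
Proof.
move=> A; apply: val_inj; rewrite /= wis_mull -[RHS]ideals_fix; congr r.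
apply/seteqP; split=> [_ [_ -> [x Ax <-]]|x Ax]; first by rewrite mul1g.
by exists 1 => //; exists x; rewrite // mul1g.
Qed.

Fact ideals_mulm1 : right_id ione imul.
Proof. by move=> A; rewrite ideals_mulC ideals_mul1m. Qed.

HB.instance Definition _ :=
  isMonoid.Build I ideals_mulA ideals_mul1m ideals_mulm1.
HB.instance Definition _ := Monoid_isCommutative.Build I ideals_mulC.

Fact ideals_onem_top : 1 = \top :> I.
Proof.
apply/eqP; rewrite eq_le lex1 le_idealsE; apply/asboolP.
by rewrite /= wis1.
Qed.

Fact ideals_mulm_bigjoin (A : I) G :
  A * bigjoin G = bigjoin [set A * B | B in G].
Proof.
apply: val_inj; rewrite /= wis_mulr.
apply/seteqP; split; apply: wis_min => x.
  move=> [a Aa [b [B GB Bb] <-]]; apply: wis_ext.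
  exists (A * B); first by exists B.
  by apply: wis_ext; exists a => //; exists b.
move=> [_ [B GB <-] /=]; apply: (wis_mono rP) => _ [a Aa [b Bb <-]].
by exists a => //; exists b => //; exists B.
Qed.

HB.instance Definition _ := CompleteLattice_isMultiplicative.Build set_display I
  ideals_onem_top ideals_mulm_bigjoin.

End IdealLattice.

Definition wire_system d (L : multLatticeType d) (H : wire L)
    (X : set (wire_monoid H)) : set (wire_monoid H) :=
  [set h | \bot <= val h <= bigjoin [set val x | x in X]].

(* Main.v *)
Require Import Defs.
From mathcomp Require Import all_boot all_order.
From mathcomp Require Import boolp classical_sets.

(** An [r]-ideal of the wire [H] is a set {h in H | h <= x} for some
    x in L, and since [H] generates [L], such a set remembers x: its join is
    x again ([wire_join_below]).  Hence taking joins and sending x to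
    {h in H | h <= x} are mutually inverse maps between [r]-ideals
    and elements of [L], and both are monotone.

    The [r]-closure does not change the join of a set
    ([wire_join_system]), and joins of product sets are products of joins
    because multiplication distributes over arbitrary joins
    ([wire_join_mulset]).  These two facts give at once that the product
    [(XY)_r] of [r]-ideals is sent to the product of their joins.  The axioms
    of a weak ideal system are inequalities between joins: (s1) holds because
    [xh <= x1 = x], (s4) because [c \bigvee X = \bigvee cX], and the other two
    because [X_r] depends only on [\bigvee X], and monotonically. *)

Set Implicit Arguments.
Unset Strict Implicit.
Unset Printing Implicit Defensive.

Import Order.TTheory.
Local Open Scope classical_set_scope.
Local Open Scope order_scope.
Local Open Scope group_scope.

Section BigJoin.
Context {d : Order.disp_t} {L : completeLatticeType d}.
Implicit Types (A B : set L) (x : L).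

Lemma bigjoin_ub A x : A x -> x <= bigjoin A.
Proof. by have [ub _] := bigjoinP A; apply: ub. Qed.

Lemma bigjoin_least A x : (forall a, A a -> a <= x) -> bigjoin A <= x.
Proof. by have [_ lub] := bigjoinP A; apply: lub. Qed.

Lemma bigjoin_mono A B : A `<=` B -> bigjoin A <= bigjoin B.
Proof. by move=> AB; apply: bigjoin_least => a /AB; apply: bigjoin_ub. Qed.

End BigJoin.

Section MultLatticeOrder.
Context {d : Order.disp_t} {L : multLatticeType d}.
Implicit Types x y z : L.

(** Binary joins are joins of pairs, so distributivity over arbitrary joins
    forces translations to be monotone. *)
Lemma mulm_le2l x y z : y <= z -> x * y <= x * z.
Proof.
move=> yz.
have -> : z = bigjoin [set y; z].
  apply/eqP; rewrite eq_le bigjoin_ub ?andTb; last by right.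
  by apply: bigjoin_least => t [] ->.
rewrite mulm_bigjoin; apply: bigjoin_ub.
by exists y => //; left.
Qed.

Lemma mulm_ler x y : x * y <= x.
Proof. by rewrite -{2}[x]mulg1; apply: mulm_le2l; rewrite onem_top lex1. Qed.

End MultLatticeOrder.

Section WireSystem.
Context {d : Order.disp_t} {L : multLatticeType d} (H : wire L).
Local Notation M := (wire_monoid H).
Local Notation r := (@wire_system d L H).
Implicit Types (X Y : set M) (h : M) (x : L).

Definition wire_join X : L := bigjoin [set val h | h in X].

Lemma wire_join_ub X h : X h -> val h <= wire_join X.
Proof. by move=> Xh; apply: bigjoin_ub; exists h. Qed.

Lemma wire_join_least X x : (forall h, X h -> val h <= x) -> wire_join X <= x.
Proof. by move=> Xx; apply: bigjoin_least => _ [h /Xx hx <-]. Qed.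

Lemma wire_join_mono X Y : X `<=` Y -> wire_join X <= wire_join Y.
Proof. by move=> XY; apply/bigjoin_mono/image_subset. Qed.

Lemma wire_systemE X h : r X h <-> val h <= wire_join X.
Proof. by rewrite /wire_system /= le0x. Qed.

Lemma wire_join_system X : wire_join (r X) = wire_join X.
Proof.
apply/eqP; rewrite eq_le wire_join_least /=; last by move=> h /wire_systemE.
by apply: wire_join_mono => h /wire_join_ub/wire_systemE.
Qed.

(** Any family in [H] with join [x] lies below [x], so the largest such family
    also has join [x]; one exists because [H] generates [L]. *)
Lemma wire_join_below x : wire_join [set h | val h <= x] = x.
Proof.
apply/eqP; rewrite eq_le wire_join_least //=.
have [A AH xE] := wire_generates H x.
rewrite {1}xE; apply: bigjoin_least => a Aa.
have -> : a = val (SigSub (mem_set (AH a Aa)) : M) by [].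
by apply: wire_join_ub; rewrite /= xE bigjoin_ub.
Qed.

Lemma wire_join_mulset X Y :
  wire_join (mulset X Y) = wire_join X * wire_join Y.
Proof.
apply/eqP; rewrite eq_le; apply/andP; split.
  apply: wire_join_least => _ [h Xh [k Yk <-]].
  apply: (@le_trans _ _ (val h * wire_join Y)).
    by apply: mulm_le2l; apply: wire_join_ub.
  by rewrite !(mulmC _ (wire_join Y)); apply/mulm_le2l/wire_join_ub.
rewrite mulm_bigjoin; apply: bigjoin_least => _ [_ [k Yk <-] <-].
rewrite mulmC mulm_bigjoin; apply: bigjoin_least => _ [_ [h Xh <-] <-].
have -> : val k * val h = val (h * k) by rewrite mulmC.
by apply: wire_join_ub; exists h => //; exists k.
Qed.

Lemma wire_join1 h : wire_join [set h] = val h.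
Proof.
by apply/eqP; rewrite eq_le wire_join_ub // wire_join_least // => _ ->.
Qed.

Lemma wire_system_weak : weak_ideal_system r.
Proof.
split=> [X _ [x Xx [h _ <-]]|X Y XY h|X|X c _ [_ -> [h /wire_systemE hX <-]]].
- by apply/wire_systemE/(le_trans (mulm_ler (val x) (val h)))/wire_join_ub.
- by move=> /wire_systemE hX; apply/wire_systemE/(le_trans hX)/wire_join_mono.
- by apply/seteqP; split=> h /wire_systemE hX; apply/wire_systemE;
    move: hX; rewrite wire_join_system.
- by apply/wire_systemE; rewrite wire_join_mulset wire_join1; apply: mulm_le2l.
Qed.

End WireSystem.

Theorem theorem4 (d : Order.disp_t) (L : multLatticeType d) (H : wire L) :
  exists rP : weak_ideal_system (@wire_system d L H),
    mlattice_isomorphic (ideals rP) L.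
Proof.
exists (wire_system_weak H).
pose f (A : ideals (wire_system_weak H)) : L := wire_join (val A).
have f_le A B : (f A <= f B) = (A <= B).
  rewrite le_idealsE; apply/idP/asboolP => [AB h Ah|]; last first.
    exact: wire_join_mono.
  by rewrite -ideals_fix; apply/wire_systemE/(le_trans _ AB)/wire_join_ub.
exists f; split=> // [|A B].
  pose g x : ideals (wire_system_weak H) :=
    SigSub (mem_set (imageT (@wire_system d L H) [set h | val h <= x])).
  have gK x : f (g x) = x by rewrite /f /= wire_join_system wire_join_below.
  exists g => // A.
  by apply/le_anti; rewrite -!f_le gK lexx.
by rewrite /f /= wire_join_system wire_join_mulset.
Qed.
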